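(* There is no real number $c$ such that $Z(L(G))\leq c\,B(G)$ for all finite simple graphs $G$.
   Context: For a finite simple graph $H$: colour each vertex black or white. A black vertex $v$ may force a white neighbour $w$ to become black if $w$ is the only white neighbour of $v$. A set $S\subseteq V(H)$ is a zero-forcing set if, colouring exactly the vertices of $S$ black and repeatedly applying this rule, all vertices eventually become black. The zero-forcing number $Z(H)$ is the minimum size of a zero-forcing set. Brushing: initially every vertex and every edge of $G$ is dirty. An initial configuration places a nonnegative integer number of brushes at each vertex. At each step a single remaining vertex $v$ fires; $v$ may fire only if the number of brushes currently at $v$ is at least the number of dirty edges currently incident with $v$. When $v$ fires, $v$ becomes clean, and each dirty edge incident with $v$ is traversed by at least one brush (distinct brushes for distinct edges; several brushes may traverse the same edge), which cleans that edge and moves those brushes to its other endpoint; excess brushes may remain at $v$ but play no further role; $v$ and its incident edges are then removed. The process ends when no vertex can fire. A configuration cleans $G$ if some such process cleans all vertices and edges. $B(G)$ is the minimum total number of brushes in a configuration that cleans $G$. $L(G)$ denotes the line graph of $G$: its vertices are the edges of $G$, two being adjacent iff they share an endpoint in $G$. *)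

(* Defs.v *)
From HB Require Import structures.
From Stdlib Require Import Relation_Operators.
From mathcomp Require Import all_boot all_order all_algebra.
From mathcomp Require Import boolp reals.

Set Implicit Arguments.
Unset Strict Implicit.
Unset Printing Implicit Defensive.

Local Open Scope nat_scope.

(* The null graph is allowed: it is the line graph of an edgeless graph. *)
Record sgraph : Type := SGraph {
  vertex :> finType;
  adj : rel vertex;
  adj_sym : symmetric adj;
  adj_irrefl : irreflexive adj }.

Definition edges (G : sgraph) : {set {set G}} :=
  [set [set p.1; p.2] | p : G * G & adj p.1 p.2].

Section LineGraph.
Variable G : sgraph.

Definition line_vertex : finType := {e : {set G} | e \in edges G}.

Definition line_adj : rel line_vertex :=
  [rel e f | (e != f) && (val e :&: val f != set0)].

Lemma line_adj_sym : symmetric line_adj.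
Proof. by move=> e f; rewrite /line_adj /= eq_sym setIC. Qed.

Lemma line_adj_irrefl : irreflexive line_adj.
Proof. by move=> e; rewrite /line_adj /= eqxx. Qed.

Definition line_graph : sgraph := SGraph line_adj_sym line_adj_irrefl.

End LineGraph.

Section ZeroForcing.
Variable H : sgraph.

Definition force (B : {set H}) (v w : H) : bool :=
  (v \in B) && ([set u | adj v u & u \notin B] == [set w]).

Definition force_step : rel {set H} :=
  [rel B B' | [exists v, exists w, force B v w && (B' == w |: B)]].

Definition zero_forcing (S : {set H}) : bool := connect force_step S [set: H].

Lemma zero_forcing_setT : zero_forcing [set: H].
Proof. exact: connect0. Qed.

Definition zero_forcing_number : nat :=
  #|[arg min_(S < [set: H] | zero_forcing S) #|S|]|.

End ZeroForcing.

Section Brushing.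
Variable G : sgraph.

Record brush_state : Type := BrushState {
  dirty_vertices : {set G};
  dirty_edges : {set {set G}};
  brushes : {ffun G -> nat} }.

Definition dirty_edges_at (s : brush_state) (v : G) : {set {set G}} :=
  [set e in dirty_edges s | v \in e].

(* [f e] is the number of brushes sent from [v] along the edge [e]; only its
   values on the dirty edges at [v] matter. *)
Definition may_fire (s : brush_state) (v : G) (f : {ffun {set G} -> nat}) : bool :=
  [&& v \in dirty_vertices s,
      #|dirty_edges_at s v| <= brushes s v,
      [forall e in dirty_edges_at s v, 0 < f e]
    & \sum_(e in dirty_edges_at s v) f e <= brushes s v].

Definition fire (s : brush_state) (v : G) (f : {ffun {set G} -> nat}) :=
  {| dirty_vertices := dirty_vertices s :\ v;
     dirty_edges := dirty_edges s :\: dirty_edges_at s v;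
     brushes := [ffun w =>
       if w == v then brushes s v - \sum_(e in dirty_edges_at s v) f e
       else brushes s w + \sum_(e in dirty_edges_at s v | w \in e) f e] |}.

Definition brush_step (s s' : brush_state) : Prop :=
  exists v f, may_fire s v f /\ s' = fire s v f.

Definition brush_init (c : {ffun G -> nat}) : brush_state :=
  BrushState [set: G] (edges G) c.

Definition cleans (c : {ffun G -> nat}) : Prop :=
  exists2 s, clos_refl_trans_1n brush_state brush_step (brush_init c) s
           & dirty_vertices s = set0 /\ dirty_edges s = set0.

Definition cleanable_with (n : nat) : Prop :=
  exists2 c : {ffun G -> nat}, cleans c & \sum_v c v = n.

Lemma clean_from (s : brush_state) :
  (forall e, e \in dirty_edges s -> e != set0 /\ e \subset dirty_vertices s) ->
  (forall v, #|dirty_edges s| <= brushes s v \/ v \notin dirty_vertices s) ->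
  exists2 s', clos_refl_trans_1n brush_state brush_step s s'
            & dirty_vertices s' = set0 /\ dirty_edges s' = set0.
Proof.
have [n] := ubnP #|dirty_vertices s|; elim: n s => // n IH s lt_n edge_in enough.
have [D0|[v vD]] := set_0Vmem (dirty_vertices s).
  exists s; first exact: rt1n_refl.
  split=> //; apply/setP=> e; rewrite inE; apply/negP=> /edge_in [e0].
  by rewrite D0 subset0 (negPf e0).
pose f : {ffun {set G} -> nat} := [ffun=> 1].
have sub_at : dirty_edges_at s v \subset dirty_edges s.
  by apply/subsetP=> e; rewrite inE => /andP[].
have le_at : #|dirty_edges_at s v| <= brushes s v.
  case: (enough v) => [|]; last by rewrite vD.
  exact: leq_trans (subset_leq_card sub_at).
have sum_f : \sum_(e in dirty_edges_at s v) f e = #|dirty_edges_at s v|.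
  by under eq_bigr do rewrite ffunE; rewrite sum1_card.
have fires : may_fire s v f.
  rewrite /may_fire vD le_at sum_f le_at andbT /=.
  by apply/forall_inP=> e _; rewrite ffunE.
have [|e|w|s' path_s' clean_s'] := IH (fire s v f).
- by move: lt_n; rewrite (cardsD1 v) vD.
- rewrite /= in_setD inE => /andP[+ eD]; rewrite eD /= => ve.
  have [e0 /subsetP sub_e] := edge_in e eD; split=> //.
  apply/subsetP=> u ue; rewrite !inE sub_e // andbT.
  by apply: contraNneq ve => <-.
- rewrite /= ffunE !inE; have [->|_] := eqVneq; first by right.
  case: (enough w) => [le_w|]; last by right.
  left; apply: leq_trans (leq_addr _ _).
  exact: leq_trans (subset_leq_card (subsetDl _ _)) le_w.
exists s' => //; apply: rt1n_trans path_s'.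
by exists v, f.
Qed.

Lemma cleanable_with_ex : exists n, `[< cleanable_with n >].
Proof.
pose c : {ffun G -> nat} := [ffun=> #|edges G|].
exists (\sum_v c v); apply/asboolP; exists c => //.
apply: clean_from => [e|v] /=; last by left; rewrite ffunE.
case/imsetP=> p _ ->; split; last exact: subsetT.
by apply/set0Pn; exists p.1; rewrite set21.
Qed.

Definition brush_number : nat := ex_minn cleanable_with_ex.

End Brushing.

(* Main.v *)
Require Import Defs.
From Stdlib Require Import Relation_Operators.
From mathcomp Require Import all_boot all_order all_algebra.
From mathcomp Require Import boolp reals.
From mathcomp Require Import zify.

(* In L(G), when an edge forces an edge through a common endpoint x, all edges
   at x become black, so x is never used again. Hence there are at most |V(G)|
   forces and Z(L(G)) >= |E(G)| - |V(G)|. The square of a path on m + 2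
   vertices has at least 2m edges, but is cleaned by 3 brushes sweeping from
   left to right, since each vertex has at most two edges to its right. *)

Set Implicit Arguments.
Unset Strict Implicit.
Unset Printing Implicit Defensive.

Local Open Scope nat_scope.

Section LineGraphForcing.
Variable G : sgraph.
Implicit Types B : {set line_graph G}.

(** The spent vertices: no white edge is left at them, so no later force can pass through them. *)
Definition saturated B : {set G} :=
  [set x | [forall e : line_graph G, (x \in val e) ==> (e \in B)]].

Lemma saturatedS B B' : B \subset B' -> saturated B \subset saturated B'.
Proof.
move=> /subsetP sBB'; apply/subsetP => x; rewrite !inE => /forall_inP satx.
by apply/forall_inP => e /satx /sBB'.
Qed.

(** Each new black edge is paid for by a newly saturated vertex, the common endpoint of [e] and [f].
    The inequality is kept additive to avoid truncated subtraction. *)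
Lemma force_saturated B e f :
  force B e f -> #|f |: B| + #|saturated B| <= #|B| + #|saturated (f |: B)|.
Proof.
case/andP=> eB /eqP whites.
have: f \in [set u | adj e u & u \notin B] by rewrite whites set11.
rewrite inE => /andP[/andP[_ /set0Pn[x /setIP[xe xf]]] fB].
rewrite cardsU1 fB addnAC addnC leq_add2l add1n.
apply: proper_card; apply/properP; split; first exact/saturatedS/subsetUr.
(* The white edge [f] shows that [x] was not saturated before. Any white edge at [x] is [e], which
   is black, or a white neighbour of [e], hence [f]. *)
exists x; rewrite inE; last by apply/forall_inP => /(_ f xf); apply/negP.
apply/forall_inP => g xg; rewrite !inE orbC.
case: (boolP (g \in B)) => //= gB.
rewrite -[g == f]in_set1 -whites inE gB andbT /adj /= /line_adj /=.
apply/andP; split; first by apply: contraNneq gB => <-.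
by apply/set0Pn; exists x; rewrite inE xe.
Qed.

Lemma zero_forcing_line_ge S :
  @zero_forcing (line_graph G) S -> #|edges G| <= #|S| + #|G|.
Proof.
case/connectP => p; have -> : #|edges G| = #|[set: line_graph G]|.
  by rewrite cardsT card_sig.
(* Telescoping along the forcing sequence; at the end at most [#|G|] vertices are saturated. *)
suff steps B : path (@force_step (line_graph G)) B p ->
    #|last B p| + #|saturated B| <= #|B| + #|saturated (last B p)|.
  move=> /steps le_last lastT; rewrite -lastT in le_last.
  apply: leq_trans (leq_add (leqnn _) (max_card (saturated setT))).
  exact: leq_trans (leq_addr _ _) le_last.
elim: p B => // B' p IH B; rewrite last_cons.
case/andP=> /existsP[e /existsP[f /andP[ef /eqP->]]] /IH.
by have := force_saturated ef; lia.
Qed.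

Lemma zero_forcing_number_line_ge :
  #|edges G| <= zero_forcing_number (line_graph G) + #|G|.
Proof.
rewrite /zero_forcing_number; case: arg_minnP => [|S + _].
  exact: zero_forcing_setT.
exact: zero_forcing_line_ge.
Qed.

End LineGraphForcing.

Section PathSquare.
Variable n : nat.

Definition path_square_adj : rel 'I_n :=
  [rel i j : 'I_n | [&& i != j, i <= j + 2 & j <= i + 2]].

Lemma path_square_adj_sym : symmetric path_square_adj.
Proof. by move=> i j; rewrite /path_square_adj /= eq_sym [(i <= _) && _]andbC. Qed.

Lemma path_square_adj_irrefl : irreflexive path_square_adj.
Proof. by move=> i; rewrite /path_square_adj /= eqxx. Qed.

Definition path_square : sgraph :=
  SGraph path_square_adj_sym path_square_adj_irrefl.

Lemma mem_edges_path_square (i j : 'I_n) :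
  i < j <= i + 2 -> [set i; j] \in edges path_square.
Proof.
move=> ij; apply/imsetP; exists (i, j) => //; rewrite inE /= /path_square_adj /= -val_eqE /=; lia.
Qed.

(** The invariant of the sweep once the vertices below [k] have fired. Truncated subtraction asks
    for 2 brushes at [k], 1 at [k + 1] and none further right. *)
Definition swept (k : nat) (s : brush_state path_square) : Prop :=
  [/\ dirty_vertices s = [set i : 'I_n | k <= i],
      dirty_edges s = [set e in edges path_square | e \subset [set i : 'I_n | k <= i]]
    & forall i : 'I_n, k <= i -> k + 2 - i <= brushes s i].

Lemma swept_dirty_edges_at (v : 'I_n) s :
  swept v s -> #|dirty_edges_at s v| <= 2.
Proof.
case=> _ dE _.
have sub : dirty_edges_at s v \subset
    [set [set v; w] | w : 'I_n in [set w : 'I_n | v < w <= v + 2]].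
  apply/subsetP => e; rewrite !inE dE inE => /andP[/andP[/imsetP[[i j]]]].
  rewrite inE /= /path_square_adj /= -val_eqE /= => ij -> /subsetP sub.
  have := sub i (set21 i j); have := sub j (set22 i j); rewrite !inE => vj vi.
  case/orP=> /eqP ev; apply/imsetP; [exists j | exists i]; rewrite ?inE ev //.
  - by subst; lia.
  - by subst; lia.
  - by rewrite setUC.
apply: leq_trans (subset_leq_card sub) _; apply: leq_trans (leq_imset_card _ _) _.
(* Comparing values in [nat] covers the right end too, where [v.+1] or [v.+2] may not be a
   vertex. *)
rewrite cardE -(size_map val); apply: (@uniq_leq_size _ _ [:: v.+1; v.+2]).
  by rewrite map_inj_uniq ?enum_uniq //; exact: val_inj.
by move=> x /mapP[w]; rewrite mem_enum !inE => w_in -> /=; lia.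
Qed.

(** Firing [v] with one brush per dirty edge raises the guarantee at [v + 1] from 1 to 2 and at
    [v + 2] from 0 to 1, which restores the invariant one place further. *)
Lemma swept_fire (v : 'I_n) s : swept v s ->
  exists2 s', brush_step s s' & swept v.+1 s'.
Proof.
move=> sw; have [dV dE br] := sw; have le2 := swept_dirty_edges_at sw.
pose f : {ffun {set path_square} -> nat} := [ffun=> 1].
have sum_f : \sum_(e in dirty_edges_at s v) f e = #|dirty_edges_at s v|.
  by under eq_bigr do rewrite ffunE; rewrite sum1_card.
have at_br : #|dirty_edges_at s v| <= brushes s v by have := br v (leqnn v); lia.
exists (fire s v f).
  exists v, f; split=> //; rewrite /may_fire dV inE leqnn at_br sum_f at_br andbT.
  by apply/forall_inP => e _; rewrite ffunE.
split=> /=.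
- by apply/setP => i; rewrite dV !inE -val_eqE /=; lia.
- apply/setP => e; rewrite !inE dE !inE negb_and.
  have [eE|_] := boolP (e \in edges path_square); last by rewrite andbF.
  rewrite /=; apply/idP/idP => [/andP[+ /subsetP sub]|/subsetP sub].
    move=> nsub; apply/subsetP => i ie; move: nsub.
    have := sub i ie; rewrite !inE => vi; case/orP=> [|ve].
      by move/negP; case; apply/subsetP.
    have : i != v by apply: contraNneq ve => <-.
    by rewrite -val_eqE /=; lia.
  apply/andP; split; last by apply/subsetP => i /sub; rewrite !inE; lia.
  by apply/orP; right; apply/negP => /sub; rewrite inE ltnn.
- move=> i lt_vi; have iv : i != v by rewrite -val_eqE /= gtn_eqF.
  rewrite ffunE (negPf iv); have br_i := br i (ltnW lt_vi).
  (* Beyond [v + 2] the required number is 0; up to there, the brush sent along [[set v; i]]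
     suffices. *)
  have [le_i|] := leqP i (v + 2); last by lia.
  rewrite (bigD1 [set v; i]) /=.
    rewrite ffunE addnA; apply: leq_trans (leq_addr _ _).
    by apply: leq_trans (leq_add br_i (leqnn 1)); lia.
  rewrite inE dE inE mem_edges_path_square ?lt_vi // set21 set22 !andbT.
  by apply/subsetP => j; rewrite !inE => /orP[] /eqP ->; lia.
Qed.

Lemma swept_cleans k s : swept k s ->
  exists2 s', clos_refl_trans_1n _ (@brush_step path_square) s s'
            & dirty_vertices s' = set0 /\ dirty_edges s' = set0.
Proof.
have [m] := ubnP (n - k); elim: m k s => // m IH k s lt_m sw.
have [le_nk|lt_kn] := leqP n k.
  have D0 : [set i : 'I_n | k <= i] = set0.
    by apply/setP => i; rewrite !inE; have := ltn_ord i; lia.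
  case: sw => dV dE _; exists s; first exact: rt1n_refl.
  rewrite dV dE D0; split=> //; apply/setP => e; rewrite !inE subset0.
  apply/andP => -[/imsetP[p _ ->] /eqP /setP /(_ p.1)].
  by rewrite !inE eqxx.
have [s1 step sw1] := @swept_fire (Ordinal lt_kn) s sw.
have [|s' steps clean] := IH _ s1 _ sw1; first by rewrite /=; lia.
by exists s' => //; apply: rt1n_trans steps.
Qed.

End PathSquare.

Lemma brush_number_path_square m : brush_number (path_square m.+2) <= 3.
Proof.
rewrite /brush_number; case: ex_minnP => b _; apply; apply/asboolP.
(* Brushes 2, 1, 0, 0, ... are exactly what the invariant demands at [k = 0]. *)
exists [ffun i : 'I_m.+2 => 2 - i].
  apply: (@swept_cleans _ 0); split=> [||i _] /=; last by rewrite ffunE.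
    by apply/setP => i; rewrite !inE.
  apply/setP => e; rewrite inE andbC.
  by rewrite (_ : e \subset _); last by apply/subsetP => i; rewrite inE.
rewrite (@big_ord_recl _ _ addn m.+1) big_ord_recl big1 ?ffunE // => i _.
by rewrite ffunE.
Qed.

Lemma card_edges_path_square m : 2 * m <= #|edges (path_square m.+2)|.
Proof.
(* The boolean selects the edge from [i] to [i + 1] or to [i + 2]; [i < m] keeps both within range,
   so [inord] is faithful. *)
pose g (p : 'I_m * bool) : {set path_square m.+2} :=
  [set inord p.1; inord (p.1 + 1 + p.2)].
have valg (i : 'I_m) (b : bool) :
  ((inord i : 'I_m.+2) = i :> nat) * ((inord (i + 1 + b) : 'I_m.+2) = i + 1 + b :> nat).
  by have := ltn_ord i; case: b; split; rewrite inordK //; lia.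
have g_inj : injective g.
  (* Testing membership of the four endpoints leaves a problem in linear arithmetic. *)
  move=> [i b] [j c] /setP eq_g.
  have := eq_g (inord i); have := eq_g (inord j).
  have := eq_g (inord (i + 1 + b)); have := eq_g (inord (j + 1 + c)).
  rewrite /g !inE /= -!val_eqE /= !(valg i b) !(valg j c).
  move=> *; have ij : i = j by apply: val_inj => /=; lia.
  by congr (_, _) => //; subst; lia.
rewrite -[m in 2 * m]card_ord -card_bool mulnC -card_prod -(card_codom g_inj).
apply: subset_leq_card; apply/subsetP => _ /codomP[[i b] ->].
by apply: mem_edges_path_square; rewrite /= !(valg i b); lia.
Qed.

Import Order.TTheory GRing.Theory Num.Theory.

Local Open Scope ring_scope.

Theorem theorem2 (R : realType) :
  ~ exists c : R, forall G : sgraph,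
      (zero_forcing_number (line_graph G))%:R <= c * (brush_number G)%:R.
Proof.
(* The absolute value covers negative [c]; [m] exceeds [3 |c|]. *)
case=> c bound; pose m := (Num.trunc (`|c| * 3%:R)).+1.
have := bound (path_square m.+2.+2); apply/negP; rewrite -ltNge.
(* At least [2 * (m + 2)] edges against [m + 4] vertices leave a surplus of [m]. *)
have le_m : (m <= zero_forcing_number (line_graph (path_square m.+2.+2)))%N.
  have := zero_forcing_number_line_ge (path_square m.+2.+2).
  have := card_edges_path_square m.+2.
  by rewrite [#|path_square _|]card_ord; lia.
apply: (@lt_le_trans _ _ m%:R); last by rewrite ler_nat.
apply: le_lt_trans (truncnS_gt (`|c| * 3%:R)).
apply: le_trans (ler_wpM2r (ler0n _ _) (ler_norm c)) _.
by rewrite ler_wpM2l // ler_nat brush_number_path_square.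
Qed.
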